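(* Let $n>m\ge 2$ be integers with $n\ge 13$. a) An integer partition in $\mathcal{P}(n,m)$ is 2-minimal if it is of the form \[ \begin{cases} 1^{m-1}(n-m+1)^1 & \text{if } n-m\le 5,\\ q^{m-r}(q+1)^r & \text{if } n-m>5,\ n>5m,\ n=qm+r,\ 0\le r<m,\\ 1^{m-\frac{n-m}{4}}\,5^{\frac{n-m}{4}} & \text{if } n-m>5,\ n\le 5m \text{ and } m-n\equiv 0 \pmod 4,\\ 1^{m-\frac{n-m+1}{4}}\,4^1\,5^{\frac{n-m-3}{4}} & \text{if } n-m>5,\ n\le 5m \text{ and } m-n\equiv 1 \pmod 4,\\ 1^{m-\frac{n-m+2}{4}}\,4^2\,5^{\frac{n-m-6}{4}} & \text{if } n-m>5,\ n\le 5m \text{ and } m-n\equiv 2 \pmod 4,\\ 1^{m-\frac{n-m-1}{4}}\,5^{\frac{n-m-5}{4}}\,6^1 & \text{if } n-m>5,\ n\le 5m \text{ and } m-n\equiv 3 \pmod 4. \end{cases} \] b) An integer partition in $\mathcal{P}(n,m)$ is 2-maximal if it is of the form \[ \begin{cases} 2^{m-1}(n-2m+2)^1 & \text{if } n>2m+2,\\ 2^{m-2}3^2 & \text{if } n=2m+2,\\ 2^{m-1}3^1 & \text{if } n=2m+1,\\ 1^{2m-n}\,2^{n-m} & \text{if } n\le 2m. \end{cases} \]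
   Context: $\mathcal{P}(n,m)$ is the set of all integer partitions $\boldsymbol{a}=(a_1,\dots,a_m)$ of $n$ into $m$ parts, i.e. $a_1,\dots,a_m$ are positive integers with $a_1+\dots+a_m=n$. The order of the parts is irrelevant. The notation $1^{\lambda_1}2^{\lambda_2}\cdots n^{\lambda_n}$ (items $i^0$ omitted) denotes the partition having exactly $\lambda_i$ parts equal to $i$; if the same base happens to appear twice in an expression, the multiplicities are added. Let $w_2(0)=0$ and $w_2(k)=\frac1k$ for $k\in\{1,\dots,n\}$, and let \[ F_{w_2}(a)=\sum_{k=0}^n\left(\binom{n-a}{k}+\binom{n-a}{k-a}\right)w_2(k), \] where $\binom{N}{k}=0$ if $k<0$ or $k>N$. A partition $\boldsymbol{a}\in\mathcal{P}(n,m)$ is called 2-minimal (resp. 2-maximal) if $\sum_{i=1}^m a_iF_{w_2}(a_i)$ attains at $\boldsymbol{a}$ its minimum (resp. maximum) over $\mathcal{P}(n,m)$. *)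

(* Defs.v *)
From mathcomp Require Import all_boot all_order all_algebra.

Set Implicit Arguments.
Unset Strict Implicit.
Unset Printing Implicit Defensive.

Import GRing.Theory.
Local Open Scope ring_scope.

(* A partition is represented by any listing of its parts; two listings denote
   the same partition exactly when they are related by perm_eq. *)
Definition partitions (n m : nat) : pred (seq nat) :=
  fun a => [&& size a == m, all (leq 1) a & sumn a == n].

(* For bs = [:: (i_1, l_1); ...; (i_k, l_k)], a is the partition
   i_1^l_1 ... i_k^l_k; tally_seq adds the multiplicities of a repeated base. *)
Definition of_type (a : seq nat) (bs : seq (nat * nat)) : Prop :=
  perm_eq a (tally_seq bs).

Definition w2 (k : nat) : rat := if k == 0%N then 0 else k%:R^-1.

(* The second binomial vanishes when k - a < 0, which truncated subtraction on
   nat would miss.  F is only meant for a <= n. *)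
Definition F (w : nat -> rat) (n a : nat) : rat :=
  \sum_(0 <= k < n.+1)
     ('C(n - a, k) + (if (a <= k)%N then 'C(n - a, k - a) else 0%N))%:R * w k.

Definition objective (n : nat) (a : seq nat) : rat :=
  \sum_(x <- a) x%:R * F w2 n x.

Definition two_minimal (n m : nat) (a : seq nat) : Prop :=
  a \in partitions n m /\
  forall b : seq nat, b \in partitions n m -> objective n a <= objective n b.

Definition two_maximal (n m : nat) (a : seq nat) : Prop :=
  a \in partitions n m /\
  forall b : seq nat, b \in partitions n m -> objective n b <= objective n a.

(* For m < n and n <= 5 * m, all subtractions below are nonnegative and all
   divisions by 4 are exact under the stated conditions. *)
Inductive min_form (n m : nat) (a : seq nat) : Prop :=
| MinForm_close of
    (n - m <= 5)%N &
    of_type a [:: (1, m - 1); (n - m + 1, 1)]%N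
| MinForm_balanced (q r : nat) of
    (n - m > 5)%N & (n > 5 * m)%N & n = (q * m + r)%N & (0 <= r < m)%N &
    of_type a [:: (q, m - r); (q + 1, r)]%N
| MinForm_mod0 of
    (n - m > 5)%N & (n <= 5 * m)%N & (m%:Z - n%:Z = 0 %[mod 4])%Z &
    of_type a [:: (1, m - (n - m) %/ 4); (5, (n - m) %/ 4)]%N
| MinForm_mod1 of
    (n - m > 5)%N & (n <= 5 * m)%N & (m%:Z - n%:Z = 1 %[mod 4])%Z &
    of_type a
      [:: (1, m - (n - m + 1) %/ 4); (4, 1); (5, (n - m - 3) %/ 4)]%N
| MinForm_mod2 of
    (n - m > 5)%N & (n <= 5 * m)%N & (m%:Z - n%:Z = 2 %[mod 4])%Z &
    of_type a
      [:: (1, m - (n - m + 2) %/ 4); (4, 2); (5, (n - m - 6) %/ 4)]%N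
| MinForm_mod3 of
    (n - m > 5)%N & (n <= 5 * m)%N & (m%:Z - n%:Z = 3 %[mod 4])%Z &
    of_type a
      [:: (1, m - (n - m - 1) %/ 4); (5, (n - m - 5) %/ 4); (6, 1)]%N.

Inductive max_form (n m : nat) (a : seq nat) : Prop :=
| MaxForm_gt of
    (n > 2 * m + 2)%N &
    of_type a [:: (2, m - 1); (n - 2 * m + 2, 1)]%N
| MaxForm_eq2 of
    n = (2 * m + 2)%N &
    of_type a [:: (2, m - 2); (3, 2)]%N
| MaxForm_eq1 of
    n = (2 * m + 1)%N &
    of_type a [:: (2, m - 1); (3, 1)]%N
| MaxForm_le of
    (n <= 2 * m)%N &
    of_type a [:: (1, 2 * m - n); (2, n - m)]%N.

(* Main.v *)
(* Put [g x = x F(x)], so that the objective is the sum of [g] over the parts.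
   Splitting the two binomials, [F(a) = A(n - a) + B(n - a, a)] with
   [A(N) = \sum_k C(N, k) / k] and [B(N, a) = \sum_k C(N, k) / (k + a)]; the
   recurrences of [A] and [B] show that [g] is decreasing from 4 on and convex
   at every integer from 5 on, and they express [g 1, ..., g 6] in closed form
   up to the common term [A(n - 6)].
   To first order [g x] is proportional to [x / 2 ^ x], for which the exchanges
   of 3 + 3 with 2 + 4 and of 4 + 4 + 4 with 1 + 5 + 6 are ties; the closed
   forms decide them when [13 <= n].
   Minimum: if [n <= 5 m], compare [g] with the chord through 1 and 5; the
   excess of a family of parts over the chord is at least a subadditive
   function of [n - m] modulo 4. If [n > 5 m], use the line through
   [(q, g q)] and [(q + 1, g (q + 1))], which lies below [g].
   Maximum: on the parts [x >= 2], [g x - g 2] is dominated by a convex, hence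
   superadditive, function of [x - 2] vanishing at 0. *)

Require Import Defs.
From mathcomp Require Import all_boot all_order all_algebra.
From mathcomp Require Import ring lra zify.

Set Implicit Arguments.
Unset Strict Implicit.
Unset Printing Implicit Defensive.

Import Order.TTheory GRing.Theory Num.Theory.
Local Open Scope ring_scope.

(** * Binomial recurrences and closed forms for the cost of the parts 1 to 6 *)

Definition hsum (N : nat) : rat := \sum_(k < N) 'C(N, k.+1)%:R / k.+1%:R.

Definition bsum (N a : nat) : rat := \sum_(k < N.+1) 'C(N, k)%:R / (k + a)%:R.

(** The first argument stands for [n - a], so the recurrences run without truncated subtraction; [n]
    is the sum of the two arguments. *)
Definition gval (N a : nat) : rat := a%:R * (hsum N + bsum N a).

Lemma F_gval (N a : nat) : (0 < a)%N -> a%:R * F w2 (N + a) a = gval N a.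
Proof.
move=> a0; rewrite /gval; congr (_ * _); rewrite /F addnK.
under eq_bigr do rewrite natrD mulrDl.
rewrite big_split /=; congr (_ + _).
  rewrite big_nat_recl //= /w2 eqxx mulr0 add0r.
  rewrite (big_cat_nat _ (n := N)) ?leq_addr //= big_mkord.
  rewrite [X in _ + X]big_nat_cond [X in _ + X]big1 ?addr0 //.
  by move=> i /andP[/andP[Ni _] _]; rewrite bin_small ?mul0r.
rewrite (big_cat_nat _ (n := a)) //=; last by lia.
rewrite big_nat_cond big1 ?add0r; last first.
  by move=> i /andP[/andP[_ ia] _]; rewrite leqNgt ia mul0r.
rewrite -{1}(add0n a) -addSn big_addn addnK big_mkord.
apply: eq_bigr => i _; rewrite leq_addl addnK /w2.
by case: eqP => // ia; lia.
Qed.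

Lemma hsumS (N : nat) : hsum N.+1 = hsum N + bsum N 1.
Proof.
rewrite /hsum /bsum.
have -> : \sum_(k < N) 'C(N, k.+1)%:R / k.+1%:R =
          \sum_(k < N.+1) 'C(N, k.+1)%:R / k.+1%:R :> rat.
  by rewrite big_ord_recr /= bin_small ?mul0r ?addr0.
rewrite -big_split /=; apply: eq_bigr => k _.
by rewrite binS natrD mulrDl addn1.
Qed.

Lemma bsumS (N a : nat) : bsum N.+1 a = bsum N a + bsum N a.+1.
Proof.
rewrite /bsum big_ord_recl /= bin0.
have -> : \sum_(k < N.+1) 'C(N, k)%:R / (k + a)%:R =
          1 / a%:R + \sum_(k < N.+1) 'C(N, k.+1)%:R / (k.+1 + a)%:R :> rat.
  by rewrite big_ord_recl /= bin0 [in RHS]big_ord_recr /= bin_small ?mul0r ?addr0.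
rewrite -addrA -big_split /=; congr (_ + _); apply: eq_bigr => k _.
by rewrite /bump /= add1n binS natrD mulrDl addnS addSn.
Qed.

Lemma exp2_sum_bin (R : nzRingType) (N : nat) :
  2 ^+ N = \sum_(k < N.+1) 'C(N, k)%:R :> R.
Proof.
rewrite -natr_sum -natrX -(addn1 1) expnDn; congr (_%:R).
by apply: eq_bigr => i _; rewrite !exp1n !muln1.
Qed.

(** Absorption turns [N.+1 * 'C(N, k)] into [k.+1 * 'C(N.+1, k.+1)]; then
    [k / (k + a) = 1 - a / (k + a)]. *)
Lemma bsum_rec (N a : nat) : (0 < a)%N ->
  N.+1%:R * bsum N a.+1 = 2 ^+ N.+1 - a%:R * bsum N.+1 a.
Proof.
move=> a0; apply/eqP; rewrite eq_sym subr_eq; apply/eqP.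
rewrite exp2_sum_bin.
have -> : N.+1%:R * bsum N a.+1 =
    \sum_(k < N.+2) k%:R * 'C(N.+1, k)%:R / (k + a)%:R.
  rewrite big_ord_recl !mul0r add0r /bsum big_distrr; apply: eq_bigr => k _ /=.
  by rewrite /bump add1n mulrA -!natrM -mul_bin_diag addnS addSn.
rewrite /bsum big_distrr -big_split /=; apply: eq_bigr => k _.
have : (k + a)%:R != 0 :> rat by rewrite pnatr_eq0; lia.
by rewrite natrD => ka0; field.
Qed.

(** The analogue of [bsum_rec] at [a = 0]; the missing term [k = 0] accounts for the [- 1]. *)
Lemma bsum1 (N : nat) : N.+1%:R * bsum N 1 = 2 ^+ N.+1 - 1.
Proof.
rewrite exp2_sum_bin big_ord_recl bin0 addrC addKr /bsum big_distrr.
apply: eq_bigr => k _ /=.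
rewrite mulrA -natrM mul_bin_diag natrM addn1 /bump add1n mulrAC mulfV ?mul1r //.
by rewrite pnatr_eq0.
Qed.

Lemma bsum_anti (N a : nat) : (0 < a)%N -> bsum N a.+1 <= bsum N a.
Proof.
move=> a0; apply: ler_sum => k _; rewrite ler_wpM2l ?ler0n //.
by rewrite lef_pV2 ?posrE ?ltr0n ?ler_nat; lia.
Qed.

(* Here [j = n - 13], [b_a = bsum (n - a) a] and [u_i = bsum (n - 6 + i) 1].
   The polynomials in [x] of the next lemmas come from putting such expressions
   over a common denominator; their coefficients are split in base 1000 because
   the unary literals would overflow the stack. *)
Lemma gval_closed (j : nat) :
  let x := j%:R in let T := 2 ^+ (j + 7) in let A := hsum (j + 7) in
  let b1 := (64 * T - 1) / (x + 13) in
  let b2 := (32 * T - b1) / (x + 12) in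
  let b3 := (16 * T - 2 * b2) / (x + 11) in
  let b4 := (8 * T - 3 * b3) / (x + 10) in
  let b5 := (4 * T - 4 * b4) / (x + 9) in
  let b6 := (2 * T - 5 * b5) / (x + 8) in
  let u0 := (2 * T - 1) / (x + 8) in
  let u1 := (4 * T - 1) / (x + 9) in
  let u2 := (8 * T - 1) / (x + 10) in
  let u3 := (16 * T - 1) / (x + 11) in
  let u4 := (32 * T - 1) / (x + 12) in
  [/\ gval (j + 12) 1 = A + u0 + u1 + u2 + u3 + u4 + b1,
      gval (j + 11) 2 = 2 * (A + u0 + u1 + u2 + u3 + b2) &
      gval (j + 10) 3 = 3 * (A + u0 + u1 + u2 + b3)] /\
  [/\ gval (j + 9) 4 = 4 * (A + u0 + u1 + b4),
      gval (j + 8) 5 = 5 * (A + u0 + b5) &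
      gval (j + 7) 6 = 6 * (A + b6)].
Proof.
have nz N : j%:R + N.+1%:R != 0 :> rat by rewrite -natrD pnatr_eq0 addnS.
have E N i : bsum (j + N) i.+2 =
    (2 ^+ (j + N.+1) - i.+1%:R * bsum (j + N.+1) i.+1) / (j%:R + N.+1%:R).
  by apply: (canRL (mulfK (nz N))); rewrite mulrC -natrD addnS bsum_rec.
have U N : bsum (j + N) 1 = (2 ^+ (j + N.+1) - 1) / (j%:R + N.+1%:R).
  by apply: (canRL (mulfK (nz N))); rewrite mulrC -natrD addnS bsum1.
have p N : 2 ^+ (j + (7 + N)) = 2 ^+ N * 2 ^+ (j + 7) :> rat by rewrite addnA exprD mulrC.
have H N : hsum (j + N.+1) = hsum (j + N) + bsum (j + N) 1 by rewrite addnS hsumS.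
rewrite /gval (H 11) (H 10) (H 9) (H 8) (H 7) !E !U (p 6) (p 5) (p 4) (p 3) (p 2) (p 1).
move: (hsum _) (2 ^+ (j + 7)) (j%:R) => A T x /=.
by do 2!split; ring.
Qed.

(** * Comparisons between parts at most 6 *)

(** The left side is [128 * (1 + j + 'C(j, 2))], the start of the binomial expansion of
    [128 * 2 ^+ j]; equality holds for [j <= 2]. *)
Lemma ler_quad_exp2 (j : nat) :
  64 * (j%:R ^+ 2 + j%:R + 2) <= 2 ^+ (j + 7) :> rat.
Proof.
elim: j => [|j IH]; first by rewrite add0n; lra.
have IH2 : 128 * (j%:R + 1) <= 2 ^+ (j + 7) :> rat.
  elim: j {IH} => [|j IH]; first by rewrite add0n; lra.
  by rewrite addSn exprS -[j.+1%:R]natr1; have := ler0n rat j; lra.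
rewrite addSn [2 ^+ _.+1]exprS -[j.+1%:R]natr1.
by move: (2 ^+ _) (j%:R) IH IH2 => T x IH IH2; lra.
Qed.

Lemma expr_ge0_2to7 (R : numDomainType) (x : R) : 0 <= x ->
  [/\ 0 <= x ^+ 2, 0 <= x ^+ 3 & 0 <= x ^+ 4] /\
  [/\ 0 <= x ^+ 5, 0 <= x ^+ 6 & 0 <= x ^+ 7].
Proof. by move=> x0; rewrite !exprn_ge0. Qed.

Lemma addr_natS_neq0 (R : numDomainType) (x : R) (i : nat) :
  0 <= x -> x + i.+1%:R != 0.
Proof. by move=> x0; rewrite lt0r_neq0 // ltr_wpDl. Qed.

(** With [N = j + 7], these are the first two terms of the expansion of [hsum N] as
    [2 ^+ N.+1 / N * (1 + 1 / N + ...)]. The bound serves [gval_1_le_2], the one comparison where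
    [A] does not cancel. *)
Lemma hsum_lower (j : nat) :
  2 * 2 ^+ (j + 7) * (j%:R + 8) <= hsum (j + 7) * (j%:R + 7) ^+ 2.
Proof.
elim: j => [|j IH].
  rewrite !add0n !hsumS.
  have U N : bsum N 1 = (2 ^+ N.+1 - 1) / N.+1%:R.
    by apply: (canRL (mulfK _)); rewrite ?pnatr_eq0 // mulrC bsum1.
  by rewrite !U /hsum big_ord0; lra.
rewrite addSn hsumS exprS -[j.+1%:R]natr1.
have := bsum1 (j + 7).
rewrite exprS -[(j + 7).+1%:R]natr1 natrD => U.
have := ler_quad_exp2 j.
have : 0 <= j%:R :> rat by [].
move: (hsum _) (bsum _ _) (2 ^+ _) (j%:R) IH U => A b T x IH U x0 Tx.
have Eb : b = (2 * T - 1) / (x + 8).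
  by apply: (canRL (mulfK _)); lra.
have x7 : 0 < (x + 7) ^+ 2 by rewrite exprn_gt0; lra.
rewrite -(ler_pM2r x7).
have -> : (A + b) * (x + 1 + 7) ^+ 2 * (x + 7) ^+ 2 =
  (A * (x + 7) ^+ 2) * (x + 8) ^+ 2 + (2 * T - 1) * (x + 8) * (x + 7) ^+ 2.
  by rewrite Eb; field; lra.
have := ler_wpM2r (sqr_ge0 (x + 8)) IH.
have : 0 <= (T - 64 * (x ^+ 2 + x + 2)) * (6 * x + 44) by rewrite mulr_ge0; lra.
have [[]] := expr_ge0_2to7 x0.
lra.
Qed.

(** Both sides of the exchange have the same sum of parts, so [A] cancels. Over a common denominator
    the numerator is [T * P x + Q x]; when [P x >= 0], bounding [T] by [ler_quad_exp2] leaves a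
    polynomial inequality. *)
Lemma gval_4_4_le_3_5 (j : nat) :
  0 <= gval (j + 10) 3 - 2 * gval (j + 9) 4 + gval (j + 8) 5.
Proof.
have [[_ _ E3] [E4 E5 _]] := gval_closed j.
rewrite E3 E4 E5 {E3 E4 E5}.
have := ler_quad_exp2 j; have : 0 <= j%:R :> rat by [].
move: (hsum _) (2 ^+ _) (j%:R) => A T x x0 Tx.
have den i := addr_natS_neq0 i x0.
have [[x2 x3 x4] [x5 x6 x7]] := expr_ge0_2to7 x0.
rewrite [X in 0 <= X](_ : _ =
  (T * ((688 * 1000 + 896) + (372 * 1000 + 896) * x + (78 * 1000 + 792) * x ^+ 2
    + (8 * 1000 + 120) * x ^+ 3 + 408 * x ^+ 4 + 8 * x ^+ 5)
   + ((307 * 1000 + 8) + (143 * 1000 + 840) * x + (26 * 1000 + 655) * x ^+ 2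
     + (2 * 1000 + 444) * x ^+ 3 + 111 * x ^+ 4 + 2 * x ^+ 5))
  / ((x + 8) * (x + 9) * (x + 10) * (x + 11) * (x + 12) * (x + 13))); last first.
  by field; rewrite !den.
apply: divr_ge0; last by rewrite !mulr_ge0 ?addr_ge0.
have : 0 <= (T - 64 * (x ^+ 2 + x + 2)) *
    ((688 * 1000 + 896) + (372 * 1000 + 896) * x + (78 * 1000 + 792) * x ^+ 2
      + (8 * 1000 + 120) * x ^+ 3 + 408 * x ^+ 4 + 8 * x ^+ 5).
  by apply: mulr_ge0; [rewrite subr_ge0 | lra].
lra.
Qed.

(** The first-order tie shows in the coefficient of [T], which has degree 3 instead of 5. *)
Lemma gval_1_5_6_le_4_4_4 (j : nat) :
  0 <= 3 * gval (j + 9) 4 - gval (j + 12) 1 - gval (j + 8) 5 - gval (j + 7) 6.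
Proof.
have [[E1 _ _] [E4 E5 E6]] := gval_closed j.
rewrite E1 E4 E5 E6 {E1 E4 E5 E6}.
have := ler_quad_exp2 j; have : 0 <= j%:R :> rat by [].
move: (hsum _) (2 ^+ _) (j%:R) => A T x x0 Tx.
have den i := addr_natS_neq0 i x0.
have [[x2 x3 x4] [x5 x6 x7]] := expr_ge0_2to7 x0.
rewrite [X in 0 <= X](_ : _ =
  (T * ((741 * 1000 + 312) + (230 * 1000 + 288) * x + (23 * 1000 + 520) * x ^+ 2
    + 784 * x ^+ 3)
   + (- ((1 * 1000 + 997) * 1000 + 424) - (929 * 1000 + 722) * x - (171 * 1000
     + 836) * x ^+ 2 - (15 * 1000 + 763) * x ^+ 3 - 718 * x ^+ 4 - 13 * x ^+ 5))
  / ((x + 8) * (x + 9) * (x + 10) * (x + 11) * (x + 12) * (x + 13))); last first.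
  by field; rewrite !den.
apply: divr_ge0; last by rewrite !mulr_ge0 ?addr_ge0.
have : 0 <= (T - 64 * (x ^+ 2 + x + 2)) *
    ((741 * 1000 + 312) + (230 * 1000 + 288) * x + (23 * 1000 + 520) * x ^+ 2
      + 784 * x ^+ 3).
  by apply: mulr_ge0; [rewrite subr_ge0 | lra].
lra.
Qed.

Lemma gval_2_4_le_3_3 (j : nat) :
  0 <= 2 * gval (j + 10) 3 - gval (j + 9) 4 - gval (j + 11) 2.
Proof.
have [[_ E2 E3] [E4 _ _]] := gval_closed j.
rewrite E2 E3 E4 {E2 E3 E4}.
have := ler_quad_exp2 j; have : 0 <= j%:R :> rat by [].
move: (hsum _) (2 ^+ _) (j%:R) => A T x x0 Tx.
have den i := addr_natS_neq0 i x0.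
have [[x2 x3 x4] [x5 x6 x7]] := expr_ge0_2to7 x0.
rewrite [X in 0 <= X](_ : _ =
  (T * ((119 * 1000 + 808) + (37 * 1000 + 504) * x + (3 * 1000 + 840) * x ^+ 2
    + 128 * x ^+ 3)
   + (- (295 * 1000 + 776) - (139 * 1000 + 388) * x - (26 * 1000 + 2) * x ^+ 2
     - (2 * 1000 + 402) * x ^+ 3 - 110 * x ^+ 4 - 2 * x ^+ 5))
  / ((x + 8) * (x + 9) * (x + 10) * (x + 11) * (x + 12) * (x + 13))); last first.
  by field; rewrite !den.
apply: divr_ge0; last by rewrite !mulr_ge0 ?addr_ge0.
have : 0 <= (T - 64 * (x ^+ 2 + x + 2)) *
    ((119 * 1000 + 808) + (37 * 1000 + 504) * x + (3 * 1000 + 840) * x ^+ 2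
      + 128 * x ^+ 3).
  by apply: mulr_ge0; [rewrite subr_ge0 | lra].
lra.
Qed.

Lemma gval_3_3_3_le_2_2_5 (j : nat) :
  0 <= gval (j + 8) 5 + 2 * gval (j + 11) 2 - 3 * gval (j + 10) 3.
Proof.
have [[_ E2 E3] [_ E5 _]] := gval_closed j.
rewrite E2 E3 E5 {E2 E3 E5}.
have := ler_quad_exp2 j; have : 0 <= j%:R :> rat by [].
move: (hsum _) (2 ^+ _) (j%:R) => A T x x0 Tx.
have den i := addr_natS_neq0 i x0.
have [[x2 x3 x4] [x5 x6 x7]] := expr_ge0_2to7 x0.
rewrite [X in 0 <= X](_ : _ =
  (T * ((449 * 1000 + 280) + (297 * 1000 + 888) * x + (71 * 1000 + 112) * x ^+ 2
    + (7 * 1000 + 864) * x ^+ 3 + 408 * x ^+ 4 + 8 * x ^+ 5)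
   + ((898 * 1000 + 560) + (422 * 1000 + 616) * x + (78 * 1000 + 659) * x ^+ 2
     + (7 * 1000 + 248) * x ^+ 3 + 331 * x ^+ 4 + 6 * x ^+ 5))
  / ((x + 8) * (x + 9) * (x + 10) * (x + 11) * (x + 12) * (x + 13))); last first.
  by field; rewrite !den.
apply: divr_ge0; last by rewrite !mulr_ge0 ?addr_ge0.
have : 0 <= (T - 64 * (x ^+ 2 + x + 2)) *
    ((449 * 1000 + 280) + (297 * 1000 + 888) * x + (71 * 1000 + 112) * x ^+ 2
      + (7 * 1000 + 864) * x ^+ 3 + 408 * x ^+ 4 + 8 * x ^+ 5).
  by apply: mulr_ge0; [rewrite subr_ge0 | lra].
lra.
Qed.

Lemma gval_4_4_5_le_1_6_6 (j : nat) :
  0 <= 2 * gval (j + 7) 6 + gval (j + 12) 1 - gval (j + 8) 5 - 2 * gval (j + 9) 4.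
Proof.
have [[E1 _ _] [E4 E5 E6]] := gval_closed j.
rewrite E1 E4 E5 E6 {E1 E4 E5 E6}.
have := ler_quad_exp2 j; have : 0 <= j%:R :> rat by [].
(* The coefficient of [T] is negative at [x = 0] and nonnegative for [x >= 1], so [j = 0] is checked
   numerically. *)
have : j%:R = 0 :> rat /\ 2 ^+ (j + 7) = 128 :> rat \/ 1 <= j%:R :> rat.
  by case: j => [|j]; [left; rewrite add0n; split=> //; lra | right; rewrite ler1n].
move: (hsum _) (2 ^+ _) (j%:R) => A T x x1 x0 Tx.
have den i := addr_natS_neq0 i x0.
have [[x2 x3 x4] [x5 x6 x7]] := expr_ge0_2to7 x0.
rewrite [X in 0 <= X](_ : _ =
  (T * (- (14 * 1000 + 976) + (156 * 1000 + 96) * x + (56 * 1000 + 712) * x ^+ 2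
    + (7 * 1000 + 384) * x ^+ 3 + 408 * x ^+ 4 + 8 * x ^+ 5)
   + (((2 * 1000 + 379) * 1000 + 312) + ((1 * 1000 + 97) * 1000 + 262) * x
     + (201 * 1000 + 314) * x ^+ 2 + (18 * 1000 + 357) * x ^+ 3 + 832 * x ^+ 4
       + 15 * x ^+ 5))
  / ((x + 8) * (x + 9) * (x + 10) * (x + 11) * (x + 12) * (x + 13))); last first.
  by field; rewrite !den.
apply: divr_ge0; last by rewrite !mulr_ge0 ?addr_ge0.
case: x1 => [[-> ->] | x1]; first by lra.
apply: addr_ge0; last by lra.
apply: mulr_ge0; lra.
Qed.

(** Parts 1 and 2 also tie to first order, and [A] remains with coefficient 1; both terms of
    [hsum_lower] are needed to leave a positive remainder. *)
Lemma gval_1_le_2 (j : nat) :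
  0 <= gval (j + 11) 2 - gval (j + 12) 1.
Proof.
have [[E1 E2 _] [_ _ _]] := gval_closed j.
rewrite E1 E2 {E1 E2}.
have := ler_quad_exp2 j; have : 0 <= j%:R :> rat by [].
have := hsum_lower j.
move: (hsum _) (2 ^+ _) (j%:R) => A T x A_ge x0 Tx.
have den i := addr_natS_neq0 i x0.
have [[x2 x3 x4] [x5 x6 x7]] := expr_ge0_2to7 x0.
have x7_gt0 : 0 < (x + 7) ^+ 2 by rewrite exprn_even_gt0 //= den.
rewrite -(ler_pdivrMr _ _ x7_gt0) -subr_ge0 in A_ge.
rewrite [X in 0 <= X](_ : _ =
  (A - 2 * T * (x + 8) / (x + 7) ^+ 2) +
  (T * (((12 * 1000 + 23) * 1000 + 184) + ((7 * 1000 + 22) * 1000 + 692) * x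
    + ((1 * 1000 + 633) * 1000 + 866) * x ^+ 2 + (189 * 1000 + 202) * x ^+ 3
      + (10 * 1000 + 902) * x ^+ 4 + 250 * x ^+ 5)
   + (- ((15 * 1000 + 373) * 1000 + 848) - ((11 * 1000 + 525) * 1000 + 164) * x
     - ((3 * 1000 + 664) * 1000 + 799) * x ^+ 2 - (640 * 1000 + 702) * x ^+ 3
       - (66 * 1000 + 510) * x ^+ 4 - (4 * 1000 + 100) * x ^+ 5 - 139 * x ^+ 6
         - 2 * x ^+ 7))
  / ((x + 8) * (x + 9) * (x + 10) * (x + 11) * (x + 12) * (x + 13)
    * (x + 7) ^+ 2)); last first.
  by field; rewrite !den.
apply: addr_ge0; first exact: A_ge.
apply: divr_ge0; last by rewrite !mulr_ge0 ?addr_ge0.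
have : 0 <= (T - 64 * (x ^+ 2 + x + 2)) *
    (((12 * 1000 + 23) * 1000 + 184) + ((7 * 1000 + 22) * 1000 + 692) * x
      + ((1 * 1000 + 633) * 1000 + 866) * x ^+ 2 + (189 * 1000 + 202) * x ^+ 3
        + (10 * 1000 + 902) * x ^+ 4 + 250 * x ^+ 5).
  by apply: mulr_ge0; [rewrite subr_ge0 | lra].
lra.
Qed.

(** * Convexity and decrease for larger parts *)

Lemma bsum1_growth (N : nat) : 3 * bsum N 1 <= 2 * bsum N.+1 1.
Proof.
have := bsum1 N; have := bsum1 N.+1; rewrite [2 ^+ N.+2]exprS -[N.+2%:R]natr1.
case: N => [|[|N]].
- by rewrite expr1; lra.
- by rewrite expr2; lra.
rewrite -[N.+3%:R]natr1 -[N.+2%:R]natr1 -[N.+1%:R]natr1 [2 ^+ N.+3]exprS.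
have : 1 <= 2 ^+ N.+2 :> rat by rewrite exprn_ege1.
have : 0 <= N%:R :> rat by [].
move: (bsum N.+3 1) (bsum N.+2 1) (2 ^+ N.+2) (N%:R) => c b T x x0 T1 Ec Eb.
have xT : 0 <= x * T by rewrite mulr_ge0 //; lra.
have p : 0 < (x + 3) * (x + 4) by rewrite mulr_gt0; lra.
rewrite -(ler_pM2r p).
have -> : 3 * b * ((x + 3) * (x + 4)) = 3 * (x + 4) * (2 * T - 1).
  by rewrite -Eb; ring.
have -> : 2 * c * ((x + 3) * (x + 4)) = 2 * (x + 3) * (2 * (2 * T) - 1).
  by rewrite -Ec; ring.
lra.
Qed.

(** The [hsum] terms of the second difference give [a * bsum N.+1 1 - (a + 2) * bsum N 1], at least
    [(a / 2 - 2) * bsum N 1] by [bsum1_growth]: hence [4 <= a]. The others reduce to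
    [a * bsum N a - 2 * bsum N a.+1]. *)
Lemma gval_convex (N a : nat) : (4 <= a)%N ->
  2 * gval N.+1 a.+1 <= gval N.+2 a + gval N a.+2.
Proof.
move=> a4; have b1 := bsum1_growth N.
have b0 : 0 <= bsum N 1.
  by apply: sumr_ge0 => k _; rewrite divr_ge0.
have b2 : bsum N a.+1 <= bsum N a by apply: bsum_anti; lia.
have b3 : 0 <= bsum N a.+1 by apply: sumr_ge0 => k _; rewrite divr_ge0.
have : 4 <= a%:R :> rat by rewrite ler_nat.
rewrite /gval !hsumS (bsumS N.+1) !bsumS -[a.+2%:R]natr1 -[a.+1%:R]natr1.
move: b1 b2; rewrite !bsumS.
move: (hsum N) (bsum N 1) (bsum N 2) (bsum N a) (bsum N a.+1) (bsum N a.+2) a%:R b0 b3.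
move=> A u u' b c d x u0 c0 uu bc x4; nra.
Qed.

Lemma gval_last (a : nat) : (0 < a)%N -> gval 0 a.+1 <= gval 1 a.
Proof.
move=> a0; rewrite /gval hsumS bsumS /hsum /bsum !big_ord0 !big_ord_recl !big_ord0 /=.
rewrite !add0n !addr0 !add0r bin0 divr1 -natr1.
have : 1 <= a%:R :> rat by rewrite ler1n.
move: a%:R => x x1; rewrite -subr_ge0 [X in 0 <= X](_ : _ = x * (1 + 1 / (x + 1))).
  by rewrite mulr_ge0 ?addr_ge0 ?divr_ge0; lra.
by field; rewrite !lt0r_neq0; lra.
Qed.

(** By convexity the differences increase up to the last one, which is nonpositive by
    [gval_last]. *)
Lemma gval_decreasing (N a : nat) : (4 <= a)%N -> gval N a.+1 <= gval N.+1 a.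
Proof.
elim: N a => [|N IH] a a4; first by apply: gval_last; lia.
by have := IH a.+1 (leqW a4); have := gval_convex N a4; lra.
Qed.

(** * The inequalities on costs used in the optimisation *)

(* [h y] is the contribution of a part [y + 1]. *)
Record cost_shape (h : nat -> rat) : Prop := CostShape {
  shape_incr : h 0 <= h 1;
  shape_anti : forall y, (3 <= y)%N -> h y.+1 <= h y;
  shape_convex : forall y, (3 <= y)%N -> 2 * h y.+1 <= h y + h y.+2;
  shape_234 : 0 <= h 2 - 2 * h 3 + h 4;
  shape_0345 : 0 <= 3 * h 3 - h 0 - h 4 - h 5;
  shape_123 : 0 <= 2 * h 2 - h 3 - h 1;
  shape_124 : 0 <= h 4 + 2 * h 1 - 3 * h 2;
  shape_0543 : 0 <= 2 * h 5 + h 0 - h 4 - 2 * h 3 }.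

(* Parts are capped at [n], since [F w2 n x] has a junk value for [n < x]. *)
Definition cost (n y : nat) : rat := gval (n - minn y.+1 n) (minn y.+1 n).

Lemma cost_shapeP (n : nat) : (13 <= n)%N -> cost_shape (cost n).
Proof.
move=> n13; have [j Ej] : exists j, n = (j + 13)%N by exists (n - 13)%N; lia.
have low a : (0 < a <= 13)%N -> cost n a.-1 = gval (j + (13 - a)) a.
  move=> a13; have E : minn a.-1.+1 n = a by lia.
  by rewrite /cost E; congr (gval _ _); lia.
have [l1 l2 l3] : [/\ cost n 0 = gval (j + 12) 1, cost n 1 = gval (j + 11) 2
  & cost n 2 = gval (j + 10) 3].
  by split; [exact: (low 1%N) | exact: (low 2%N) | exact: (low 3%N)].
have [l4 l5 l6] : [/\ cost n 3 = gval (j + 9) 4, cost n 4 = gval (j + 8) 5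
  & cost n 5 = gval (j + 7) 6].
  by split; [exact: (low 4%N) | exact: (low 5%N) | exact: (low 6%N)].
split; rewrite ?l1 ?l2 ?l3 ?l4 ?l5 ?l6.
- by rewrite -subr_ge0; apply: gval_1_le_2.
- move=> y y3; rewrite /cost; have [yn|ny] : (y.+1 < n)%N \/ (n <= y.+1)%N by lia.
    have -> : minn y.+2 n = y.+2 by lia.
    have -> : minn y.+1 n = y.+1 by lia.
    by rewrite -(subnSK yn); apply: gval_decreasing.
  have -> : minn y.+2 n = n by lia.
  by have -> : minn y.+1 n = n by lia.
- move=> y y3; rewrite /cost;
  have [yn|[En|ny]] : (y.+2 < n)%N \/ n = y.+2 \/ (n <= y.+1)%N by lia.
    have [-> -> ->] : [/\ minn y.+3 n = y.+3, minn y.+2 n = y.+2 & minn y.+1 n = y.+1]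
      by split; lia.
    have [-> ->] : (n - y.+1 = (n - y.+3).+2 /\ n - y.+2 = (n - y.+3).+1)%N by lia.
    by apply: gval_convex.
    (* The cost is constant beyond part [n], so convexity at [n] amounts to the last decrease. *)
    have [-> -> ->] : [/\ minn y.+3 n = y.+2, minn y.+2 n = y.+2 & minn y.+1 n = y.+1]
      by split; lia.
    have [-> ->] : (n - y.+1 = 1 /\ n - y.+2 = 0)%N by lia.
    have := @gval_decreasing 0 y.+1 y3; lra.
  have [-> -> ->] : [/\ minn y.+3 n = n, minn y.+2 n = n & minn y.+1 n = n]
    by split; lia.
  by lra.
- exact: gval_4_4_le_3_5.
- exact: gval_1_5_6_le_4_4_4.
- exact: gval_2_4_le_3_3.
- exact: gval_3_3_3_le_2_2_5.
- exact: gval_4_4_5_le_1_6_6.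
Qed.

(** * Discrete convexity and its extension to small parts *)

Lemma slope_mono (R : realFieldType) (u : nat -> R) (s x y : nat) :
  (forall z, (s <= z)%N -> 2 * u z.+1 <= u z + u z.+2) -> (s <= x <= y)%N ->
  u x.+1 - u x <= u y.+1 - u y.
Proof.
move=> conv /andP[sx /subnK <-]; elim: (y - x)%N => [|k IH] //.
apply: (le_trans IH); rewrite addSn.
by have := conv (k + x)%N (leq_trans sx (leq_addl _ _)); lra.
Qed.

Lemma convex_superadditive (R : realFieldType) (u : nat -> R) (x y : nat) : u 0 = 0 ->
  (forall z, 2 * u z.+1 <= u z + u z.+2) -> u x + u y <= u (x + y)%N.
Proof.
move=> u0 conv; elim: y => [|y IH]; first by rewrite addn0 u0 addr0.
have := @slope_mono R u 0 y (x + y) (fun z _ => conv z).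
by rewrite leq_addl addnS => /(_ isT); lra.
Qed.

Lemma support_line (R : realFieldType) (u : nat -> R) (s q x : nat) :
  (forall z, (s <= z)%N -> 2 * u z.+1 <= u z + u z.+2) -> (s <= q)%N -> (s <= x)%N ->
  u q + (x%:R - q%:R) * (u q.+1 - u q) <= u x.
Proof.
move=> conv sq sx; have mono a b := @slope_mono R u s a b conv.
case: (leqP q x) => [|/ltnW] /subnK E.
  rewrite -E; elim: (x - q)%N => [|k IH]; first by rewrite add0n subrr mul0r addr0.
  apply: (le_trans (y := u (k + q)%N + (u q.+1 - u q))).
    by rewrite -subr_ge0 in IH *; rewrite -subr_ge0 addSn -natr1; lra.
  by have := mono q (k + q)%N; rewrite sq leq_addl addSn => /(_ isT); lra.
rewrite -E; move: sq E => _ _; elim: (q - x)%N => [|k IH].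
  by rewrite add0n subrr mul0r addr0.
have := mono (k + x)%N (k + x).+1; rewrite leqnSn andbT addSn.
rewrite (leq_trans sx (leq_addl _ _)) => /(_ isT) sl.
have k0 : 0 <= k%:R :> R by [].
rewrite natrD in IH; rewrite -natr1 natrD.
move: sl IH; move: (u _) (u _) (u _) (u _) (k%:R) (x%:R) k0 => a b c d K X K0 sl IH; nra.
Qed.

(** [shape_anti] starts at index 3; [shape_234] and then [shape_124] carry the decrease down to
    index 1. *)
Lemma cost_le4 (h : nat -> rat) : cost_shape h ->
  [/\ h 1 >= h 2, h 2 >= h 3, h 3 >= h 4 & h 4 >= h 5].
Proof.
case=> i an cv v vi m3 m4 iv.
by have := an 3%N isT; have := an 4%N isT; split; lra.
Qed.

Lemma shape_convex2 (h : nat -> rat) : cost_shape h ->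
  forall y, (2 <= y)%N -> 2 * h y.+1 <= h y + h y.+2.
Proof.
move=> H y; rewrite leq_eqVlt => /orP[/eqP <- | y3]; last exact: shape_convex.
by have := shape_234 H; lra.
Qed.

(** * Lower bounds for a sum of costs *)

(* The least excess of a family of parts over the chord through parts 1 and 5,
   as a function of the sum of [part - 1] modulo 4. *)
Definition min_excess (h : nat -> rat) (d : nat) : rat :=
  nth 0 [:: 0; h 5 - h 0 - 5 * ((h 4 - h 0) / 4);
    2 * (h 3 - h 0 - 3 * ((h 4 - h 0) / 4)); h 3 - h 0 - 3 * ((h 4 - h 0) / 4)] (d %% 4).

Lemma modn4_ge5 (y : nat) : (5 <= y ->
  y %% 4 = 0 \/ y %% 4 = 1 \/ (y %% 4 = 2 /\ 6 <= y) \/ (y %% 4 = 3 /\ 7 <= y))%N.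
Proof. by lia. Qed.

(** Let [f] be the excess over the chord, so [f 0 = f 4 = 0]. [shape_0345] and [shape_0543] say
    [f 5 <= 3 * f 3] and [f 3 <= f 5], forcing both to be nonnegative. From 5 on, the line through 4
    and 5 gives [f y >= (y - 4) * f 5]. *)
Lemma min_excess_le (h : nat -> rat) (y : nat) : cost_shape h ->
  min_excess h y <= h y - h 0 - y%:R * ((h 4 - h 0) / 4).
Proof.
move=> H; have [a12 a23 a34 a45] := cost_le4 H.
have [i _ _ v vi m3 m4 iv] := H; have c4 := shape_convex H (isT : 3 <= 3)%N.
have [y5|y5] := ltnP y 5.
  by case: y y5 => [|[|[|[|[|y]]]]] y5; [| | | | |by []]; rewrite /min_excess /=; lra.
have L := @support_line _ h 2 4 y (shape_convex2 H) isT (leq_trans _ y5).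
have {}L := L isT.
rewrite /min_excess.
have yR : 5 <= y%:R :> rat by rewrite ler_nat.
have e5 : 0 <= h 5 - h 4 - (h 4 - h 0) / 4 by lra.
have [E|[[E]|[[E y6]|[E y7]]]] := modn4_ge5 y5.
- by rewrite E /=; nra.
- by rewrite E /=; nra.
- have : 6 <= y%:R :> rat by rewrite ler_nat.
  by rewrite E /=; nra.
have : 7 <= y%:R :> rat by rewrite ler_nat.
by rewrite E /=; nra.
Qed.

(** A finite check on residues; the critical ones are 2 + 3, by [shape_0345], and 1 + 1, by
    [shape_0543]. *)
Lemma min_excess_subadditive (h : nat -> rat) (x y : nat) : cost_shape h ->
  min_excess h (x + y) <= min_excess h x + min_excess h y.
Proof.
move=> H; have [a12 a23 a34 a45] := cost_le4 H.
have [i _ _ v vi m3 m4 iv] := H; have c4 := shape_convex H (isT : 3 <= 3)%N.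
rewrite /min_excess -modnDm.
have := ltn_pmod x (isT : 0 < 4)%N; have := ltn_pmod y (isT : 0 < 4)%N.
by move: (x %% 4)%N (y %% 4)%N => [|[|[|[|r]]]] // [|[|[|[|s]]]] // _ _ /=; lra.
Qed.

Lemma sum_ge_chord (h : nat -> rat) (c : seq nat) : cost_shape h ->
  (size c)%:R * h 0 + (sumn c)%:R * ((h 4 - h 0) / 4) + min_excess h (sumn c)
    <= \sum_(y <- c) h y.
Proof.
move=> H; elim: c => [|y c IH]; first by rewrite big_nil /= !mul0r !add0r.
rewrite big_cons /= -natr1 natrD.
by have := min_excess_le y H; have := min_excess_subadditive y (sumn c) H; lra.
Qed.

Lemma sum_ge_single (h : nat -> rat) (c : seq nat) : cost_shape h ->
  (sumn c <= 5)%N -> (size c)%:R * h 0 + (h (sumn c) - h 0) <= \sum_(y <- c) h y.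
Proof.
move=> H; have [a12 a23 a34 a45] := cost_le4 H.
have [i _ _ v vi m3 m4 iv] := H; have c4 := shape_convex H (isT : 3 <= 3)%N.
elim: c => [|y c IH] /=; first by rewrite big_nil /= !mul0r subrr addr0.
move=> s5; have {IH} := IH (leq_trans (leq_addl _ _) s5).
rewrite big_cons -natr1.
(* Merging two excesses into one part never costs more while the total is at most 5. *)
suff : h (y + sumn c)%N + h 0 <= h y + h (sumn c) by lra.
move: (sumn c) s5 => s.
by case: y => [|[|[|[|[|[|y]]]]]]; case: s => [|[|[|[|[|[|s]]]]]] //= _; lra.
Qed.

(** Convexity starts at index 2. For [y < 2] the line at 4 lies below [h], and left of 4 the line at
    [q] lies below the line at 4. *)
Lemma chord_le (h : nat -> rat) (q y : nat) : cost_shape h -> (4 <= q)%N ->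
  h q + (y%:R - q%:R) * (h q.+1 - h q) <= h y.
Proof.
move=> H q4; have c2 := shape_convex2 H.
have [y2|y2] := leqP 2 y; first by apply: support_line c2 _ y2; lia.
have [a12 a23 a34 a45] := cost_le4 H.
have [i _ _ v vi m3 m4 iv] := H; have c4 := shape_convex H (isT : 3 <= 3)%N.
have L4 := @support_line _ h 2 q 4 c2 (leq_trans (isT : 2 <= 4)%N q4) isT.
have S : h 5 - h 4 <= h q.+1 - h q by apply: (slope_mono c2).
have : h 4 + (y%:R - 4) * (h 5 - h 4) <= h y.
  by case: y y2 => [|[|y]] // _; lra.
have : (y%:R - 4) * (h q.+1 - h q) <= (y%:R - 4) * (h 5 - h 4).
  apply: ler_wnM2l S.
  by rewrite subr_le0 (ler_nat _ y 4) (leq_trans (ltnW y2)).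
by lra.
Qed.

Lemma sum_ge_tangent (h : nat -> rat) (q : nat) (c : seq nat) :
  cost_shape h -> (4 <= q)%N ->
  (size c)%:R * h q + ((sumn c)%:R - (size c)%:R * q%:R) * (h q.+1 - h q)
    <= \sum_(y <- c) h y.
Proof.
move=> H q4; elim: c => [|y c IH]; first by rewrite big_nil /=; lra.
rewrite big_cons /= -natr1 natrD.
by have := chord_le y H q4; lra.
Qed.

(** * Upper bound for a sum of costs *)

(* A convex majorant of [h y.+1 - h 1]: they differ only at [y = 2], that is for
   a part 4, because 2 + 4 is worse than 3 + 3. *)
Definition max_excess (h : nat -> rat) (y : nat) : rat :=
  if (y < 3)%N then y%:R * (h 2 - h 1) else h y.+1 - h 1.

(** At the junction of the two branches, [y = 1] is [shape_124], and [y = 2] combines [shape_123]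
    with convexity at index 3. *)
Lemma max_excess_convex (h : nat -> rat) : cost_shape h ->
  forall y, 2 * max_excess h y.+1 <= max_excess h y + max_excess h y.+2.
Proof.
move=> H; have [a12 a23 a34 a45] := cost_le4 H.
have [i _ c v vi m3 m4 iv] := H; have c4 := shape_convex H (isT : 3 <= 3)%N.
move=> [|[|[|y]]]; rewrite /max_excess /=; try lra.
by have := c y.+4 isT; lra.
Qed.

Lemma max_excess_anti (h : nat -> rat) : cost_shape h ->
  forall y, max_excess h y.+1 <= max_excess h y.
Proof.
move=> H; have [a12 a23 a34 a45] := cost_le4 H.
have [i an _ v vi m3 m4 iv] := H; have c4 := shape_convex H (isT : 3 <= 3)%N.
move=> [|[|[|y]]]; rewrite /max_excess /=; try lra.
by have := an y.+4 isT; lra.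
Qed.

Lemma max_excess_nonincr (h : nat -> rat) (x y : nat) : cost_shape h ->
  (x <= y)%N -> max_excess h y <= max_excess h x.
Proof.
move=> H /subnK <-; elim: (y - x)%N => [|k IH] //.
exact: le_trans (max_excess_anti H _) IH.
Qed.

(** The baseline is [p] parts equal to 2. A deficit is paid by parts 1; a surplus [s - p] goes into
    the majorant at once. *)
Definition max_total (h : nat -> rat) (p s : nat) : rat :=
  if (s <= p)%N then - (p - s)%:R * (h 1 - h 0) else max_excess h (s - p).

(** Adding a part at least 2 to a surplus uses superadditivity; the other cases use that
    [max_excess] is nonincreasing and [h 0 <= h 1]. *)
Lemma sum_le_max_total (h : nat -> rat) (c : seq nat) : cost_shape h ->
  \sum_(y <- c) h y <= (size c)%:R * h 1 + max_total h (size c) (sumn c).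
Proof.
move=> H; have i := shape_incr H.
have anti x y := @max_excess_nonincr h x y H.
have K0 : max_excess h 0 = 0 by rewrite /max_excess mul0r.
elim: c => [|y c IH].
  by rewrite big_nil /max_total [size _]/= [sumn _]/= leqnn subnn; lra.
rewrite big_cons [size _]/= [sumn _]/= -natr1.
suff : max_total h (size c) (sumn c) + (h y - h 1)
  <= max_total h (size c).+1 (y + sumn c) by lra.
move: (size c) (sumn c) => p s {IH c}; rewrite /max_total.
case: y => [|y].
  rewrite add0n; have [sp|ps] := leqP s p.
    by rewrite leqW // subSn // -natr1; lra.
  rewrite leq_eqVlt ltnS leqNgt ps orbF subnS; case: eqP => [->|/eqP sp].
    by rewrite subSnn subnn; have := anti 0%N 1%N isT; lra.
  by have := anti (s - p).-1 (s - p)%N (leq_pred _); lra.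
have hy : h y.+1 - h 1 <= max_excess h y.
  have [a12 a23 a34 a45] := cost_le4 H.
  by case: y => [|[|[|y]]]; rewrite /max_excess /=; have := shape_123 H; lra.
rewrite addSn ltnS subSS; have [sp|ps] := leqP s p; last first.
  rewrite leqNgt (leq_trans ps (leq_addl _ _)) /=.
  have := convex_superadditive y (s - p) K0 (max_excess_convex H).
  by rewrite addnBA ?(ltnW ps) //; lra.
have y0 := anti 0%N y (leq0n y).
case: leqP => [ysp|pys].
  have : (p - (y + s))%:R * (h 1 - h 0) <= (p - s)%:R * (h 1 - h 0).
    by rewrite ler_wpM2r ?subr_ge0 // ler_nat; lia.
  by lra.
have := anti (y + s - p)%N y; rewrite leq_subLR [(p + y)%N]addnC leq_add2l => /(_ sp).
have : 0 <= (p - s)%:R * (h 1 - h 0) by rewrite mulr_ge0 ?subr_ge0.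
by lra.
Qed.

(** * Transfer to partitions and attainment of the bounds *)

Lemma objective_cost (n m : nat) (b : seq nat) : b \in partitions n m ->
  objective n b = \sum_(y <- map predn b) cost n y.
Proof.
case/and3P => _ /allP b1 /eqP bn; rewrite big_map; apply: eq_big_seq => x xb.
have x1 := b1 _ xb; have xn : (x <= n)%N.
  by rewrite -bn sumnE; rewrite (big_rem x) //= leq_addr.
rewrite /cost prednK // (minn_idPl xn) -F_gval //.
by rewrite subnK.
Qed.

Lemma size_sumn_pred (n m : nat) (b : seq nat) : b \in partitions n m ->
  size (map predn b) = m /\ (sumn (map predn b) + m = n)%N.
Proof.
case/and3P => /eqP <- b1 /eqP <-; rewrite size_map; split=> //.
by elim: b b1 => [|x b IH] //= /andP[x1 /IH]; lia.
Qed.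

Lemma sum_of_type (h : nat -> rat) (a : seq nat) (bs : seq (nat * nat)) :
  of_type a bs -> \sum_(x <- a) h x = \sum_(p <- bs) h p.1 *+ p.2.
Proof.
move=> /(perm_big _) ->; elim: bs => [|[x k] bs IH]; first by rewrite !big_nil.
by rewrite big_cons /= -IH big_cat /= big_nseq iter_addr_0.
Qed.

Lemma size_of_type (a : seq nat) (bs : seq (nat * nat)) :
  of_type a bs -> size a = sumn (unzip2 bs).
Proof. by move=> /perm_size ->; rewrite size_tally_seq. Qed.

Lemma sumn_of_type (a : seq nat) (bs : seq (nat * nat)) :
  of_type a bs -> sumn a = sumn [seq p.1 * p.2 | p <- bs]%N.
Proof.
move=> /perm_sumn ->; elim: bs => [|[x k] bs IH] //=.
by rewrite -IH sumn_cat sumn_nseq.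
Qed.

Lemma objective_of_type (n m : nat) (a : seq nat) (bs : seq (nat * nat)) :
  a \in partitions n m -> of_type a bs ->
  objective n a = \sum_(p <- bs) p.2%:R * cost n p.1.-1.
Proof.
move=> aP ta; rewrite (objective_cost aP) big_map (sum_of_type _ ta).
by apply: eq_bigr => p _; rewrite mulr_natl.
Qed.

Lemma objective_ge_chord (n m : nat) (b : seq nat) : (13 <= n)%N ->
  b \in partitions n m ->
  m%:R * cost n 0 + (n - m)%:R * ((cost n 4 - cost n 0) / 4)
    + min_excess (cost n) (n - m) <= objective n b.
Proof.
move=> hn bP; rewrite (objective_cost bP).
have := sum_ge_chord (map predn b) (cost_shapeP hn).
by have [-> <-] := size_sumn_pred bP; rewrite addnK.
Qed.

Lemma min_form_minimal (n m : nat) (a : seq nat) : (13 <= n)%N ->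
  a \in partitions n m -> min_form n m a -> two_minimal n m a.
Proof.
move=> hn aP fa; split=> // b bP; have H := cost_shapeP hn.
have /and3P[/eqP sza _ /eqP sma] := aP.
have chord := objective_ge_chord hn bP.
case: fa => [dm ta|q r dm nm5 E /andP[_ rm] ta
    |dm nm5 _ ta|dm nm5 _ ta|dm nm5 _ ta|dm nm5 _ ta];
  have := size_of_type ta; have := sumn_of_type ta;
  rewrite (objective_of_type aP ta) sza sma !big_cons big_nil /=.
- move=> Es Ez; rewrite (objective_cost bP).
  have [Eb Sb] := size_sumn_pred bP.
  have := sum_ge_single H; move/(_ (map predn b)); rewrite Eb.
  have -> : sumn (map predn b) = (n - m)%N by lia.
  move=> /(_ dm); rewrite addn1 /=.
  have -> : m%:R = (m - 1 + 1)%:R :> rat by congr (_%:R); lia.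
  by rewrite !natrD; lra.
- move=> Es Ez; rewrite (objective_cost bP).
  have [Eb Sb] := size_sumn_pred bP.
  (* [n > 5 * m] with [r < m] forces this; the tangent is taken at index [q.-1], that is at part
     [q]. *)
  have q5 : (5 <= q)%N by nia.
  have := @sum_ge_tangent _ q.-1 (map predn b) H; rewrite Eb.
  have -> : (4 <= q.-1)%N by lia.
  move=> /(_ isT); rewrite prednK ?addn1 /=; last by lia.
  have -> : (sumn (map predn b))%:R = m%:R * (q.-1)%:R + r%:R :> rat.
    by rewrite -natrM -natrD; congr (_%:R); nia.
  have -> : m%:R = ((m - r) + r)%:R :> rat by congr (_%:R); lia.
  by rewrite !natrD; lra.
(* The size and sum of [a] tie [n - m] to the multiplicities, so the quotients can be
   generalized. *)
- move: ((n - m) %/ 4)%N (m - (n - m) %/ 4)%N => k p Es Ez.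
  have D : (n - m = 4 * k)%N by lia.
  move: chord; rewrite D /min_excess modnMr /= natrM.
  have -> : m%:R = (p + k)%:R :> rat by congr (_%:R); lia.
  by rewrite !natrD; lra.
- move: (m - (n - m + 1) %/ 4)%N ((n - m - 3) %/ 4)%N => p k Es Ez.
  have D : (n - m = k * 4 + 3)%N by lia.
  move: chord; rewrite D /min_excess modnMDl /= natrD natrM.
  have -> : m%:R = (p + k + 1)%:R :> rat by congr (_%:R); lia.
  by rewrite !natrD; lra.
- move: (m - (n - m + 2) %/ 4)%N ((n - m - 6) %/ 4)%N => p k Es Ez.
  have D : (n - m = k * 4 + 6)%N by lia.
  move: chord; rewrite D /min_excess modnMDl /= natrD natrM.
  have -> : m%:R = (p + k + 2)%:R :> rat by congr (_%:R); lia.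
  by rewrite !natrD; lra.
move: (m - (n - m - 1) %/ 4)%N ((n - m - 5) %/ 4)%N => p k Es Ez.
have D : (n - m = k * 4 + 5)%N by lia.
move: chord; rewrite D /min_excess modnMDl /= natrD natrM.
have -> : m%:R = (p + k + 1)%:R :> rat by congr (_%:R); lia.
by rewrite !natrD; lra.
Qed.

Lemma max_form_maximal (n m : nat) (a : seq nat) : (13 <= n)%N -> (2 <= m)%N ->
  a \in partitions n m -> max_form n m a -> two_maximal n m a.
Proof.
move=> hn hm aP fa; split=> // b bP; have H := cost_shapeP hn.
rewrite (objective_cost bP); have := sum_le_max_total (map predn b) H.
have [-> Sb] := size_sumn_pred bP; rewrite /max_total.
have -> : sumn (map predn b) = (n - m)%N by lia.
have mn : (m <= n)%N by lia.
move=> ub; apply: (le_trans ub) => {ub b bP Sb}.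
case: fa => [nm ta|nm ta|nm ta|nm ta];
  rewrite (objective_of_type aP ta) !big_cons big_nil /=.
- have -> : (n - m <= m)%N = false by lia.
  rewrite /max_excess; have -> : (n - m - m < 3)%N = false by lia.
  have -> : (n - 2 * m + 2).-1 = (n - m - m).+1 by lia.
  have -> : m%:R = (m - 1 + 1)%:R :> rat by congr (_%:R); lia.
  by rewrite !natrD; lra.
(* Surplus 2 falls on the linear branch of [max_excess], whose value is that of two parts 3. *)
- have -> : (n - m <= m)%N = false by lia.
  have -> : (n - m - m = 2)%N by lia.
  have -> : m%:R = (m - 2 + 2)%:R :> rat by congr (_%:R); lia.
  by rewrite !natrD /max_excess /=; lra.
- have -> : (n - m <= m)%N = false by lia.
  have -> : (n - m - m = 1)%N by lia.
  have -> : m%:R = (m - 1 + 1)%:R :> rat by congr (_%:R); lia.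
  by rewrite !natrD /max_excess /=; lra.
have -> : (n - m <= m)%N by lia.
have -> : (m - (n - m) = 2 * m - n)%N by lia.
have -> : m%:R = ((2 * m - n) + (n - m))%:R :> rat by congr (_%:R); lia.
by rewrite !natrD; lra.
Qed.

Local Close Scope ring_scope.

Theorem theorem2 (n m : nat) (hm : 2 <= m) (hmn : m < n) (hn : 13 <= n) :
  (forall a : seq nat,
     a \in partitions n m -> min_form n m a -> two_minimal n m a) /\
  (forall a : seq nat,
     a \in partitions n m -> max_form n m a -> two_maximal n m a).
Proof.
by split=> a aP; [exact: min_form_minimal | exact: max_form_maximal].
Qed.
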